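(* Let $G$ be an $n$-vertex graph that is enumeratively chromatic-choosable. Then for every $k \in \mathbb{N}$, $$\frac{P(G,k+1)}{(k+1)^n} \geq \frac{P(G,k)}{k^n}.$$
   Context: All graphs are finite, simple, and nonempty (at least one vertex). $\mathbb{N}$ denotes the set of positive integers and $[k]=\{1,\ldots,k\}$. A proper $k$-coloring of $G$ is a function $f: V(G) \to [k]$ with $f(u) \neq f(v)$ whenever $uv \in E(G)$; $P(G,k)$ denotes the number of proper $k$-colorings of $G$, and the chromatic number $\chi(G)$ is the smallest $k \in \mathbb{N}$ for which $G$ has a proper $k$-coloring. A list assignment $L$ of $G$ assigns to each $v \in V(G)$ a set $L(v)$ of colors; it is a $k$-assignment if $|L(v)| = k$ for every $v$. A proper $L$-coloring is a function $f$ on $V(G)$ with $f(v) \in L(v)$ for every $v$ and $f(u) \neq f(v)$ whenever $uv \in E(G)$. $P(G,L)$ is the number of proper $L$-colorings of $G$, and $P_{\ell}(G,k)$ is the minimum of $P(G,L)$ over all $k$-assignments $L$ of $G$. A graph $G$ is enumeratively chromatic-choosable if $P_{\ell}(G,k) = P(G,k)$ for all integers $k \geq \chi(G)$. *)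

(* Defs.v *)
From HB Require Import structures.
From mathcomp Require Import all_boot all_order all_algebra finmap.
From mathcomp Require Import boolp.
Set Implicit Arguments.
Unset Strict Implicit.
Unset Printing Implicit Defensive.

Record sgraph := SGraph {
  vertex :> finType;
  adj : rel vertex;
  adj_sym : symmetric adj;
  adj_irrefl : irreflexive adj;
  vertex_gt0 : 0 < #|vertex| }.

Section Coloring.
Variable G : sgraph.

(* The colours 1, .., k are encoded as the elements 0, .., k - 1 of 'I_k. *)
Definition colorings (k : nat) : {set {ffun G -> 'I_k}} :=
  [set f : {ffun G -> 'I_k} | [forall u, forall v, adj u v ==> (f u != f v)]].

Definition P (k : nat) : nat := #|colorings k|.

Lemma colorable_exists : exists k, (0 < k) && (0 < P k).
Proof.
exists #|G|; rewrite vertex_gt0 /=; apply/card_gt0P.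
exists [ffun v : G => enum_rank v]; rewrite inE.
apply/forallP => u; apply/forallP => v; apply/implyP => uv.
rewrite !ffunE; apply/eqP => /enum_rank_inj uv'.
by rewrite uv' adj_irrefl in uv.
Qed.

Definition chi : nat := ex_minn colorable_exists.

(* Colours are natural numbers; as G is finite, an infinite countable palette is
   as general as any other. *)
Definition list_assignment := G -> {fset nat}.

Definition is_assignment (k : nat) (L : list_assignment) : Prop :=
  forall v, #|` L v| = k.

(* A choice f v \in L v for every v is an element of the dependent product of
   the finite types L v. *)
Definition list_colorings (L : list_assignment) :
    {set {dffun forall v : G, L v}} :=
  [set f : {dffun forall v : G, L v} |
    [forall u, forall v, adj u v ==> (val (f u) != val (f v))]].

Definition PL (L : list_assignment) : nat := #|list_colorings L|.

Lemma list_count_exists (k : nat) :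
  exists m, `[< exists2 L, is_assignment k L & PL L = m >].
Proof.
pose L : list_assignment := fun=> [fset i | i in iota 0 k]%fset.
exists (PL L); apply/asboolP; exists L => // v.
by rewrite card_fseq undup_id ?iota_uniq // size_iota.
Qed.

(* The minimum of PL L over all k-assignments L; boolp decides attainment. *)
Definition Pell (k : nat) : nat := ex_minn (list_count_exists k).

Definition enum_chromatic_choosable : Prop :=
  forall k, chi <= k -> Pell k = P k.

End Coloring.

(* Main.v *)
Require Import Defs.
From mathcomp Require Import all_boot all_order all_algebra.
From mathcomp Require Import finmap boolp.
Import Order.TTheory GRing.Theory Num.Theory.
Local Open Scope ring_scope.

(** Work with the palette of k + 1 colours and let every vertex v discard one
    colour m v.  The remaining colours form a k-assignment, so it has at least
    Pell G k proper list colourings, and these are the proper (k+1)-colourings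
    f with f v != m v at every v.  Summing over all (k+1)^n choices of m counts
    each proper (k+1)-colouring f once for every m that differs from f
    everywhere, that is k^n times.  Hence, for every graph,
      (k+1)^n * Pell G k <= k^n * P G (k+1)   ([expn_Pell_le]).
    When G is enumeratively chromatic-choosable and chi G <= k, Pell G k is
    P G k and dividing gives the corollary; when k < chi G, P G k = 0 and the
    fraction for k vanishes. *)

Section OmittedColours.
Variables (G : sgraph) (k : nat).
Implicit Types (m f : {ffun G -> 'I_k.+1}).

Definition omit_assignment m : list_assignment G :=
  fun v => [fset i | i in rem (val (m v)) (iota 0 k.+1)]%fset.

Lemma mem_omit_assignment m v i :
  (i \in omit_assignment m v) = (i != m v) && (i < k.+1)%N.
Proof. by rewrite in_fset mem_rem_uniq ?iota_uniq // inE mem_iota. Qed.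

Lemma is_assignment_omit m : is_assignment k (omit_assignment m).
Proof.
move=> v; rewrite card_fseq undup_id ?rem_uniq ?iota_uniq // size_rem.
  by rewrite size_iota.
by rewrite mem_iota add0n /=.
Qed.

Definition avoiding_colorings m : {set {ffun G -> 'I_k.+1}} :=
  [set f in colorings G k.+1 | [forall v, f v != m v]].

(** Colours of the lists lie below k + 1, so reading them in 'I_k.+1 loses
    nothing: the injection below only changes the type of the colours. *)
Lemma PL_omit_le m : (PL (omit_assignment m) <= #|avoiding_colorings m|)%N.
Proof.
pose h (g : {dffun forall v : G, omit_assignment m v}) : {ffun G -> 'I_k.+1} :=
  [ffun v => inord (val (g v))].
have gP (g : {dffun forall v : G, omit_assignment m v}) v :
    (val (g v) != m v) && (val (g v) < k.+1)%N.
  by rewrite -mem_omit_assignment; apply: valP.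
have hE g v : h g v = val (g v) :> nat.
  by rewrite ffunE inordK //; case/andP: (gP g v).
have h_inj : injective h.
  by move=> g g' /ffunP gg'; apply/ffunP => v; apply: val_inj; rewrite -!hE gg'.
rewrite /PL -(card_imset _ h_inj); apply/subset_leq_card/subsetP => f.
case/imsetP=> g; rewrite inE => /'forall_forallP g_proper ->{f}.
rewrite !inE; apply/andP; split.
  apply/'forall_forallP => u v; apply/implyP => uv.
  by rewrite -val_eqE /= !hE (implyP (g_proper u v)).
by apply/forallP => v; rewrite -val_eqE /= hE; case/andP: (gP g v).
Qed.

(** At each vertex the value of m can be any of the k colours other than f v. *)
Lemma card_differing_everywhere f :
  #|[set m : {ffun G -> 'I_k.+1} | [forall v, f v != m v]]| = (k ^ #|G|)%N.
Proof.
rewrite -(eq_card (A := family (fun v => predC1 (f v)))); last first.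
  move=> m; rewrite inE; apply: eq_forallb => v.
  by rewrite !inE eq_sym.
rewrite card_family foldrE big_map big_enum /=.
under eq_bigr do rewrite cardC1 card_ord.
by rewrite prod_nat_const.
Qed.

Lemma sum_avoiding_colorings :
  (\sum_m #|avoiding_colorings m| = k ^ #|G| * P G k.+1)%N.
Proof.
under eq_bigr do rewrite -sum1_card.
rewrite (exchange_big_dep (mem (colorings G k.+1))) /=; last first.
  by move=> m f _; rewrite inE => /andP[].
rewrite mulnC -sum_nat_const; apply: eq_bigr => f f_proper.
rewrite sum1_card -(card_differing_everywhere f).
apply: eq_card => m; rewrite inE -[LHS]/(f \in avoiding_colorings m).
by rewrite inE f_proper.
Qed.

End OmittedColours.

Lemma Pell_le (G : sgraph) (k : nat) (L : list_assignment G) :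
  is_assignment k L -> (Pell G k <= PL L)%N.
Proof.
move=> Lk; rewrite /Pell; case: ex_minnP => p _; apply.
by apply/asboolP; exists L.
Qed.

(** The averaging inequality: the least number of list colourings is at most
    the mean over the assignments that omit one of k + 1 colours per vertex. *)
Lemma expn_Pell_le (G : sgraph) (k : nat) :
  (k.+1 ^ #|G| * Pell G k <= k ^ #|G| * P G k.+1)%N.
Proof.
rewrite -sum_avoiding_colorings -[X in (X ^ _)%N]card_ord -card_ffun.
rewrite -sum_nat_const; apply: leq_sum => m _.
exact: leq_trans (Pell_le _ _ _ (is_assignment_omit _ _ m)) (PL_omit_le _ _ m).
Qed.

Lemma P_lt_chi (G : sgraph) (k : nat) :
  (0 < k)%N -> (k < chi G)%N -> P G k = 0%N.
Proof.
rewrite /chi => k_gt0; case: ex_minnP => c _ c_min k_lt_c.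
apply/eqP; rewrite -leqn0 leqNgt; apply/negP => Pk_gt0.
by move: (c_min k); rewrite k_gt0 Pk_gt0 leqNgt k_lt_c => /(_ isT).
Qed.

Theorem corollary4 (G : sgraph) (n : nat) (hn : #|G| = n)
    (hG : enum_chromatic_choosable G) (k : nat) (hk : (0 < k)%N) :
  (P G k.+1)%:R / k.+1%:R ^+ n >= (P G k)%:R / k%:R ^+ n :> rat.
Proof.
have [chi_le_k | k_lt_chi] := leqP (chi G) k; last first.
  by rewrite (P_lt_chi G k) // mul0r divr_ge0 // exprn_ge0 // ler0n.
rewrite ler_pdivrMr ?exprn_gt0 ?ltr0n // mulrAC.
rewrite ler_pdivlMr ?exprn_gt0 ?ltr0n // -!natrX -!natrM ler_nat.
by rewrite -hn -(hG k chi_le_k) mulnC [leqRHS]mulnC expn_Pell_le.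
Qed.
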